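(* Consider a fourth-order homogeneous quadratic ordinary differential equation $$\sum_{0\le l\le k,\ k+l\le 4}\alpha_{k,l}(t)\,\frac{d^kf}{dt^k}\,\frac{d^lf}{dt^l}=0,\qquad \alpha_{k,l}\in\mathbb{C}[t],\quad \alpha_{4,0}\not\equiv 0,$$ for an unknown function $f(t)$. Suppose that its fixed singular points on $\mathbb{P}^1$ are exactly $t=0,1,\infty$, and that it is of type (H) at each of these three points. Then there exist constants $\beta_1,\dots,\beta_6\in\mathbb{C}$ such that the equation can be written, after multiplying its left-hand side by a nonzero rational function of $t$, as $\mathcal{L}\,f\cdot f=0$, where \begin{align*} \mathcal{L}=\ &(t-1)^4\mathcal{D}_{\log t}^4+2(t-1)^3(t+1)\,\delta\,\mathcal{D}_{\log t}^2+t(t-1)^2\delta^2\\ &+(t-1)^2\bigl(t(t-1)+1-\beta_1-\beta_5t-\beta_6t^2\bigr)\mathcal{D}_{\log t}^2\\ &+t(t-1)\bigl(\beta_4(t-1)-\beta_1-\beta_5-\beta_6\bigr)\delta+t(t-1)(\beta_2t+\beta_3). \end{align*}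
   Context: Notation. $\delta=t\frac{d}{dt}$. The Hirota derivative for $\delta$ is $$\mathcal{D}_{\log t}^N f\cdot g=\sum_{i=0}^N(-1)^i\binom{N}{i}(\delta^{N-i}f)(\delta^i g).$$ For an independent variable $u$ in place of $t$, put $\delta_u=u\frac{d}{du}$ and define $\mathcal{D}_{\log u}$ by the same formula with $\delta_u$. Expressions such as $\delta^j\mathcal{D}_{\log t}^k\, f\cdot f$ mean $\delta^j\bigl(\mathcal{D}_{\log t}^k f\cdot f\bigr)$; with $k=0$, $\delta^j f\cdot f=\delta^j(f^2)$, and a function $c(t)$ acts by $c(t)\,f\cdot f=c(t)f^2$. Fixed singular points. A point $t_0\in\mathbb{C}$ is a fixed singular point of the equation if it is a zero of the coefficient $\alpha_{4,0}$ of the highest-order term $f\,\frac{d^4f}{dt^4}$. The point $t=\infty$ is a fixed singular point if $s=0$ is a fixed singular point after the change of variable $s=1/t$ (clearing denominators so that coefficients are polynomials in $s$). Type (H). Let $u=t-t_0$ for $t_0\in\mathbb{C}$, and $u=1/t$ for $t_0=\infty$. Rewrite the left-hand side of the equation as a finite sum $\sum_{N} u^N P_N$, where each $P_N$ is a linear combination with constant coefficients of products $\delta_u^kf\,\delta_u^lf$ (so the degree is counted with $\deg u=1$ and $\deg \frac{d}{du}=-1$). The equation is of type (H) at $t_0$ if, for the smallest $N$ with $P_N\ne0$, $P_N$ is a (nonzero) constant multiple of $$\bigl[\mathcal{D}_{\log u}^4+(1+4\alpha-2\delta_u)\mathcal{D}_{\log u}^2\bigr]f\cdot f$$ for some constant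 $\alpha\in\mathbb{C}$ (depending on $t_0$). *)

(* Defs.v *)
From HB Require Import structures.
From mathcomp Require Import all_boot all_order all_algebra fraction complex.
From mathcomp Require Import reals.

Set Implicit Arguments.
Unset Strict Implicit.
Unset Printing Implicit Defensive.

Import Order.TTheory GRing.Theory Num.Theory.
Local Open Scope ring_scope.

Notation "p %:F" := (tofrac p) : ring_scope.

(* {fraction {poly C}} is C(t), with 'X in the role of t.

   An identity between differential expressions in the unknown function f is
   read as: it holds for every element f of every commutative differential
   algebra over (C(t), d/dt), whose constants contain C.  The differential
   polynomials C(t){f} form such an algebra, so this is the same as equality
   of differential polynomials. *)
Structure diffAlg (C : fieldType) := DiffAlg {
  diffAlg_sort :> comAlgType {fraction {poly C}};
  ddt : diffAlg_sort -> diffAlg_sort;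
  ddtD : forall x y, ddt (x + y) = ddt x + ddt y;
  ddtM : forall x y, ddt (x * y) = ddt x * y + x * ddt y;
  ddt_const : forall c : C, ddt (c%:P%:F)%:A = 0;
  ddt_t : ddt ('X%:F)%:A = 1
}.
Arguments ddt {C d} _.

Section DifferentialExpressions.
Variable C : fieldType.
Local Notation K := {fraction {poly C}}.

Definition constK (c : C) : K := c%:P%:F.

(* The general quadratic form of order at most 4 in f with respect to the
   derivation d.  Passing between d/dt, d/du and u d/du does not increase
   k + l, so the same index range serves for all of them. *)
Definition quad (A : comAlgType K) (d : A -> A) (c : nat -> nat -> K) (f : A)
    : A :=
  \sum_(k < 5) \sum_(l < 5 | (l <= k)%N && (k + l <= 4)%N)
    c k l *: (iter k d f * iter l d f).

Definition lhs (a : nat -> nat -> {poly C}) (A : diffAlg C) (f : A) : A :=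
  quad ddt (fun k l => (a k l)%:F) f.

Definition hirota (A : comAlgType K) (d : A -> A) (N : nat) (f g : A) : A :=
  \sum_(i < N.+1)
    (-1) ^+ i * (iter (N - i) d f * iter i d g) *+ 'C(N, i).

(* Points of the projective line: Some t0 is the point t = t0, None is
   t = oo. *)
Definition local_param (p : option C) : K :=
  if p is Some t0 then ('X - t0%:P)%:F else ('X%:F)^-1.

(* d/du for u = local_param p; when u = 1/t, d/du = - t^2 d/dt. *)
Definition ddu (p : option C) (A : diffAlg C) (x : A) : A :=
  if p is Some _ then ddt x else - (('X ^+ 2)%:F *: ddt x).

Definition delta_u (p : option C) (A : diffAlg C) (x : A) : A :=
  local_param p *: ddu p x.

Definition delta (A : diffAlg C) (x : A) : A := 'X%:F *: ddt x.

(* b(s) for s = 1/t *)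
Definition at_inv_t (b : {poly C}) : K :=
  (map_poly constK b).[local_param None].

(* s^M times the left-hand side, written in s = 1/t and d/ds, has the
   polynomial coefficients b k l in s. *)
Definition cleared_at_infty (a : nat -> nat -> {poly C}) (M : nat)
    (b : nat -> nat -> {poly C}) : Prop :=
  forall (A : diffAlg C) (f : A),
    local_param None ^+ M *: lhs a f
      = quad (@ddu None A) (fun k l => at_inv_t (b k l)) f.

(* At infinity the denominators are cleared by the least power of s that does
   so; a larger power would make s = 0 a zero of every coefficient. *)
Definition fixed_singular (a : nat -> nat -> {poly C}) (p : option C) : Prop :=
  match p with
  | Some t0 => root (a 4%N 0%N) t0
  | None => exists M b,
      [/\ cleared_at_infty a M b,
          forall M' b', cleared_at_infty a M' b' -> (M <= M')%N
        & root (b 4%N 0%N) 0]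
  end.

(* [D_{log u}^4 + (1 + 4 alpha - 2 delta_u) D_{log u}^2] f.f *)
Definition H_form (p : option C) (alpha : C) (A : diffAlg C) (f : A) : A :=
  let du := @delta_u p A in
  let D2 := hirota du 2 f f in
  hirota du 4 f f + (constK (1 + 4%:R * alpha) *: D2 - 2%:R *: du D2).

(* The left-hand side is expanded as the sum of u^(N + j) P_j for j <= n, with
   P_j = quad delta_u (c j).  Since kappa != 0 and f delta_u^4 f has
   coefficient 2 in H_form, P_0 != 0, that is, N is the smallest exponent that
   occurs. *)
Definition typeH (a : nat -> nat -> {poly C}) (p : option C) : Prop :=
  exists (N : int) (n : nat) (c : nat -> nat -> nat -> C),
    (forall (A : diffAlg C) (f : A),
       lhs a f = \sum_(j < n.+1) local_param p ^ (N + j%:Z) *: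
                   quad (@delta_u p A) (fun k l => constK (c j k l)) f)
    /\
    exists kappa alpha : C, kappa != 0 /\
      forall (A : diffAlg C) (f : A),
        quad (@delta_u p A) (fun k l => constK (c 0%N k l)) f
          = constK kappa *: H_form p alpha f.

(* L f.f *)
Definition Lff (b1 b2 b3 b4 b5 b6 : C) (A : diffAlg C) (f : A) : A :=
  let t : {poly C} := 'X in
  let D2 := hirota (@delta A) 2 f f in
  let D4 := hirota (@delta A) 4 f f in
    ((t - 1) ^+ 4)%:F *: D4
  + (2%:R * (t - 1) ^+ 3 * (t + 1))%:F *: delta D2
  + (t * (t - 1) ^+ 2)%:F *: delta (delta (f * f))
  + ((t - 1) ^+ 2 * (t * (t - 1) + 1 - b1%:P - b5%:P * t - b6%:P * t ^+ 2))%:F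
      *: D2
  + (t * (t - 1) * (b4%:P * (t - 1) - b1%:P - b5%:P - b6%:P))%:F
      *: delta (f * f)
  + (t * (t - 1) * (b2%:P * t + b3%:P))%:F *: (f * f).

End DifferentialExpressions.

(* Main.v *)
Require Import Defs.
From HB Require Import structures.
From mathcomp Require Import all_boot all_order all_algebra fraction complex.
From mathcomp Require Import reals generic_quotient.
From mathcomp Require Import ring zify.
Set Implicit Arguments.
Unset Strict Implicit.
Unset Printing Implicit Defensive.
Import Order.TTheory GRing.Theory Num.Theory.
Local Open Scope ring_scope.
Local Open Scope complex_scope.

(* Since [u^m (d/du)^m] is a polynomial in [u d/du] with constant coefficients,
   type (H) at [t0] says that, up to a common power of [u = t - t0], the
   coefficient of [f^(k) f^(l)] is [u^(k+l)] times a power series in [u] whose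
   constant term is explicit in [alpha]; similarly at infinity, with [t^(k+l)]
   and series in [1/t].  The leading coefficient has no zeros besides [0] and
   [1], so it is a constant times [t^m (t-1)^n].  Dividing by it, the
   coefficient of [f^(k) f^(l)] becomes [t^(k+l-4) (t-1)^(k+l-4) e_kl] with a
   polynomial [e_kl] of degree at most [4 - k - l], whose values at [0], [1] and
   infinity (the coefficient of degree [4 - k - l]) are prescribed by the three
   constants [alpha].  For [k + l >= 2] this determines [e_kl]; one parameter
   remains free in [e_10] and two in [e_00].  Together with the three [alpha]
   these are the six constants [beta]. *)

(** * Derivations of a field of fractions *)

Lemma frac_numden (D : idomainType) (x : {fraction D}) :
  x = (\n_(repr x))%:F / (\d_(repr x))%:F.
Proof.
have dn0 : (\d_(repr x))%:F != 0 by rewrite tofrac_eq0 denom_ratioP.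
apply: (mulIf dn0); rewrite divfK //.
rewrite -[X in X * _ = _]reprK; set y := repr x in dn0 *.
unlock tofrac; rewrite -[LHS]FracField.pi_mul; apply/eqmodP.
rewrite /= FracField.equivfE /FracField.mulf.
by rewrite !numden_Ratio ?mulf_neq0 ?oner_eq0 ?denom_ratioP // !mulr1 mulrC.
Qed.

Lemma add_frac (D : idomainType) (x y : {fraction D}) (n m n' m' : D) :
    m != 0 -> m' != 0 -> x = n%:F / m%:F -> y = n'%:F / m'%:F ->
  x + y = (n * m' + n' * m)%:F / (m * m')%:F.
Proof.
move=> m_neq0 m'_neq0 -> ->; rewrite tofracD !tofracM.
by apply: addf_div; rewrite tofrac_eq0.
Qed.

Section FractionDerivation.
Variables (D : idomainType) (d : D -> D).
Hypothesis dD : forall x y, d (x + y) = d x + d y.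
Hypothesis dM : forall x y, d (x * y) = d x * y + x * d y.

Definition quotient_rule (n m : D) : {fraction D} :=
  (d n * m - n * d m)%:F / (m ^+ 2)%:F.

(** Computed on the representative picked by [repr]; [quotient_rule_wd] makes the choice
    irrelevant. *)
Definition frac_deriv (x : {fraction D}) : {fraction D} :=
  quotient_rule \n_(repr x) \d_(repr x).

Lemma quotient_rule_wd (n m n' m' : D) : m != 0 -> m' != 0 ->
  n%:F / m%:F = n'%:F / m'%:F -> quotient_rule n m = quotient_rule n' m'.
Proof.
move=> m_neq0 m'_neq0 /eqP.
rewrite eqr_div ?tofrac_eq0 // -!tofracM tofrac_eq => /eqP e.
apply/eqP; rewrite eqr_div ?tofrac_eq0 ?expf_neq0 // -!tofracM tofrac_eq.
have /(congr1 d) := e; rewrite !dM => e'.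
apply/eqP.
(* The numerator is expressed through [n * m'] and its derivative, which [e] and [e'] exchange for
   those of [n' * m]. *)
have -> : (d n * m - n * d m) * m' ^+ 2 =
  (d n * m' + n * d m') * (m * m') - (n * m') * (d m * m' + m * d m') by ring.
by rewrite e' e; ring.
Qed.

Lemma frac_derivE (n m : D) : m != 0 ->
  frac_deriv (n%:F / m%:F) = quotient_rule n m.
Proof.
move=> m_neq0; apply: quotient_rule_wd => //; first exact: denom_ratioP.
by rewrite -frac_numden.
Qed.

Lemma frac_deriv_tofrac (x : D) : frac_deriv x%:F = (d x)%:F.
Proof.
have d1 : d 1 = 0.
  by apply: (addIr (d 1)); rewrite add0r -{3}(mulr1 1) dM mulr1 mul1r.
rewrite -[x%:F]divr1 -tofrac1 frac_derivE ?oner_eq0 // /quotient_rule.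
by rewrite d1 mulr0 mulr1 subr0 expr1n tofrac1 divr1.
Qed.

Lemma frac_derivD x y : frac_deriv (x + y) = frac_deriv x + frac_deriv y.
Proof.
have nx := denom_ratioP (repr x); have ny := denom_ratioP (repr y).
rewrite (add_frac nx ny (frac_numden x) (frac_numden y)).
rewrite frac_derivE ?mulf_neq0 //.
have [nx2 ny2] := (expf_neq0 2 nx, expf_neq0 2 ny).
rewrite /frac_deriv (add_frac nx2 ny2 erefl erefl).
apply/eqP; rewrite eqr_div ?tofrac_eq0 ?expf_neq0 ?mulf_neq0 ?expf_neq0 //.
by rewrite -!tofracM tofrac_eq !(dM, dD); apply/eqP; ring.
Qed.

Lemma frac_derivM x y :
  frac_deriv (x * y) = frac_deriv x * y + x * frac_deriv y.
Proof.
rewrite [in RHS]/frac_deriv.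
move: (frac_numden x) (frac_numden y).
move: (denom_ratioP (repr x)) (denom_ratioP (repr y)).
move: (\n_ _) (\d_ _) (\n_ _) (\d_ _) => n m n' m' m_neq0 m'_neq0 -> ->.
rewrite mulf_div -!tofracM frac_derivE ?mulf_neq0 //.
rewrite /quotient_rule !mulf_div -!tofracM.
rewrite (add_frac _ _ erefl erefl) ?mulf_neq0 ?expf_neq0 //.
apply/eqP; rewrite eqr_div ?tofrac_eq0 ?expf_neq0 ?mulf_neq0 ?expf_neq0 //.
by rewrite -!tofracM tofrac_eq !dM; apply/eqP; ring.
Qed.

End FractionDerivation.

(** * Rational functions as a differential algebra *)

Section RationalFunctions.
Variable C : fieldType.
Local Notation K := {fraction {poly C}}.

Definition ratfun_ddt : K -> K := frac_deriv (@deriv C).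

Lemma ratfun_ddt_poly (p : {poly C}) : ratfun_ddt p%:F = (p^`())%:F.
Proof. exact: frac_deriv_tofrac (@derivM C) p. Qed.

Lemma ratfun_ddt_scale (p : {poly C}) : ratfun_ddt (p%:F *: (1 : K^o)) = (p^`())%:F.
Proof. by rewrite -ratfun_ddt_poly; congr ratfun_ddt; exact: mulr1. Qed.

(** The test object: identities valid in every differential algebra get specialised to it. [Defined]
    lets its carrier and [ddt] compute. *)
Definition ratfun_diffAlg : diffAlg C.
Proof.
apply: (@DiffAlg C K^o ratfun_ddt).
- exact: frac_derivD (@derivD C) (@derivM C).
- exact: frac_derivM (@derivM C).
- by move=> c; rewrite ratfun_ddt_scale derivC tofrac0.
- by rewrite ratfun_ddt_scale derivX tofrac1.
Defined.
End RationalFunctions.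

(** * Quadratic differential forms and Euler operators *)

Definition quad_index (k l : nat) : bool := (l <= k)%N && (k + l <= 4)%N.

Lemma quad_index_ind (P : nat -> nat -> Prop) :
  P 0%N 0%N -> P 1%N 0%N -> P 1%N 1%N -> P 2%N 0%N -> P 2%N 1%N ->
  P 2%N 2%N -> P 3%N 0%N -> P 3%N 1%N -> P 4%N 0%N ->
  forall k l, quad_index k l -> P k l.
Proof.
move=> ? ? ? ? ? ? ? ? ?; rewrite /quad_index.
by case=> [|[|[|[|[|k]]]]] [|[|[|[|[|l]]]]] //; rewrite ?addSn ?addnS ?andbF.
Qed.

(* [euler_coef c k l] is the coefficient of [u^(k+l) f^(k) f^(l)] in
   [quad (u d/du) c f]; the constants are Stirling numbers. *)
Definition euler_coef (V : nmodType) (c : nat -> nat -> V) (k l : nat) : V :=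
  match k, l with
  | 0%N, 0%N => c 0%N 0%N
  | 1%N, 0%N => c 1%N 0%N + c 2%N 0%N + c 3%N 0%N + c 4%N 0%N
  | 1%N, 1%N => c 1%N 1%N + c 2%N 1%N + c 2%N 2%N + c 3%N 1%N
  | 2%N, 0%N => c 2%N 0%N + c 3%N 0%N *+ 3 + c 4%N 0%N *+ 7
  | 2%N, 1%N => c 2%N 1%N + c 2%N 2%N *+ 2 + c 3%N 1%N *+ 3
  | 2%N, 2%N => c 2%N 2%N
  | 3%N, 0%N => c 3%N 0%N + c 4%N 0%N *+ 6
  | 3%N, 1%N => c 3%N 1%N
  | 4%N, 0%N => c 4%N 0%N
  | _, _ => 0
  end.

Lemma raddf_euler_coef (V W : nmodType) (g : {additive V -> W}) c k l :
  g (euler_coef c k l) = euler_coef (fun k l => g (c k l)) k l.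
Proof.
by case: k l => [|[|[|[|[|k]]]]] [|[|[|l]]];
  rewrite //= ?raddf0 // !raddfD ?raddfMn.
Qed.

Lemma eq_euler_coef (V : nmodType) (c c' : nat -> nat -> V) :
  (forall k l, c k l = c' k l) -> forall k l, euler_coef c k l = euler_coef c' k l.
Proof. by move=> e [|[|[|[|[|k]]]]] [|[|[|l]]]; rewrite /= ?e. Qed.

(* Taking the coefficients of [quad] in the algebra itself makes [ring]
   applicable. *)
Definition qform (B : comNzRingType) (d : B -> B) (c : nat -> nat -> B) f :=
  \sum_(k < 5) \sum_(l < 5 | quad_index k l) c k l * (iter k d f * iter l d f).

Section QForm.
Variable B : comNzRingType.
Implicit Types (d : B -> B) (c : nat -> nat -> B) (f : B).

Lemma qformE d c f : qform d c f =
    c 0%N 0%N * (f * f) + c 1%N 0%N * (d f * f) + c 1%N 1%N * (d f * d f)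
  + c 2%N 0%N * (d (d f) * f) + c 2%N 1%N * (d (d f) * d f)
  + c 2%N 2%N * (d (d f) * d (d f)) + c 3%N 0%N * (d (d (d f)) * f)
  + c 3%N 1%N * (d (d (d f)) * d f) + c 4%N 0%N * (d (d (d (d f))) * f).
Proof.
rewrite /qform !big_ord_recl big_ord0.
do 5!rewrite big_mkcond !big_ord_recl big_ord0 /=.
by rewrite !(addr0, add0r) !addrA.
Qed.

Lemma eq_qform d d' c c' f : d =1 d' ->
  (forall k l, quad_index k l -> c k l = c' k l) -> qform d c f = qform d' c' f.
Proof.
move=> ed e; apply: eq_bigr => k _; apply: eq_bigr => l kl.
by rewrite !(eq_iter ed) e.
Qed.

Lemma qform_opp d c f : (forall x, d (- x) = - d x) ->
  qform (fun x => - d x) c f = qform d (fun k l => (-1) ^+ (k + l) * c k l) f.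
Proof.
move=> dN; rewrite !qformE /= !(dN, addn0, addnS).
by do 8 try congr (_ + _); ring.
Qed.

(** By Leibniz and [d u = 1], [(u d)^2 = u^2 d^2 + u d], [(u d)^3 = u^3 d^3 + 3 u^2 d^2 + u d] and
    [(u d)^4 = u^4 d^4 + 6 u^3 d^3 + 7 u^2 d^2 + u d]. *)
Lemma qform_euler d u c f :
  (forall x y, d (x + y) = d x + d y) ->
  (forall x y, d (x * y) = d x * y + x * d y) -> d u = 1 ->
  qform (fun x => u * d x) c f
    = qform d (fun k l => u ^+ (k + l) * euler_coef c k l) f.
Proof.
move=> dD dM du; rewrite !qformE /= !(mul1r, du, dD, dM, addn0, addnS).
move: (d f) (d (d f)) (d (d (d f))) (d (d (d (d f)))) => f1 f2 f3 f4.

ring.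
Qed.

End QForm.
Section QuadraticForms.
Variable C : fieldType.
Local Notation K := {fraction {poly C}}.
Implicit Types (A : comAlgType K) (c : nat -> nat -> K).

Lemma quad_qform A (d : A -> A) c f :
  quad d c f = qform d (fun k l => (c k l)%:A) f.
Proof.
by apply: eq_bigr => k _; apply: eq_bigr => l _; rewrite mulr_algl.
Qed.

Lemma eq_quad A (d d' : A -> A) c c' f : d =1 d' ->
  (forall k l, quad_index k l -> c k l = c' k l) -> quad d c f = quad d' c' f.
Proof.
by move=> ed e; rewrite !quad_qform; apply: eq_qform => // k l kl; rewrite e.
Qed.

Lemma quadZ A (d : A -> A) x c f :
  x *: quad d c f = quad d (fun k l => x * c k l) f.
Proof.
rewrite scaler_sumr; apply: eq_bigr => k _; rewrite scaler_sumr.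
by apply: eq_bigr => l _; rewrite scalerA.
Qed.

Lemma quad_sum A (d : A -> A) n (c : 'I_n -> nat -> nat -> K) f :
  \sum_(j < n) quad d (c j) f = quad d (fun k l => \sum_(j < n) c j k l) f.
Proof.
rewrite exchange_big; apply: eq_bigr => k _; rewrite exchange_big.
by apply: eq_bigr => l _; rewrite scaler_suml.
Qed.

Lemma quad_opp A (d : A -> A) c f : (forall x, d (- x) = - d x) ->
  quad (fun x => - d x) c f = quad d (fun k l => (-1) ^+ (k + l) * c k l) f.
Proof.
move=> dN; rewrite !quad_qform qform_opp //; apply: eq_qform => // k l _.
by rewrite -[RHS]/(in_alg A _) rmorphM rmorph_sign.
Qed.

Lemma quad_euler (A : diffAlg C) (u : K) c (f : A) : ddt (u%:A : A) = 1 ->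
  quad (fun x => u *: ddt x) c f
    = quad ddt (fun k l => u ^+ (k + l) * euler_coef c k l) f.
Proof.
move=> du; rewrite !quad_qform.
rewrite (@eq_qform _ _ (fun x : A => u%:A * ddt x) _ (fun k l => (c k l)%:A)) //;
  last first.
  by move=> x; rewrite mulr_algl.
rewrite qform_euler //; [|exact: ddtD|exact: ddtM].
apply: eq_qform => // k l _.
have gE : in_alg A (u ^+ (k + l) * euler_coef c k l) =
    in_alg A u ^+ (k + l) * euler_coef (fun i j => in_alg A (c i j)) k l.
  by rewrite rmorphM rmorphXn raddf_euler_coef.
by rewrite -[LHS]gE.
Qed.

End QuadraticForms.
(* The values at [1, t, t + 1, t^2, t^2 + 1, t^2 + t, ...] determine the
   coefficients one after the other. *)
Lemma qform_eq0 (F : fieldType) (d : F -> F) (t : F) (c : nat -> nat -> F) :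
    24%:R != 0 :> F ->
    (forall x y, d (x + y) = d x + d y) ->
    (forall x y, d (x * y) = d x * y + x * d y) -> d t = 1 ->
    (forall f, qform d c f = 0) ->
  forall k l, quad_index k l -> c k l = 0.
Proof.
move=> n24 dD dM dt q.
have d1 : d 1 = 0.
  by apply: (addIr (d 1)); rewrite add0r -{3}(mulr1 1) dM mulr1 mul1r.
have d0 : d 0 = 0 by apply: (addIr (d 0)); rewrite -dD !add0r.
have dE := (dt, d1, d0, dD, dM, mul1r, mul0r, mulr1, mulr0, addr0, add0r).
have sub0 x y : x = 0 -> y = 0 -> x - y = 0 :> F by move=> -> ->; rewrite subrr.
have c00 : c 0%N 0%N = 0 by have := q 1; rewrite qformE !dE.
have q1 := q t; have q1' := q (t + 1).
rewrite !qformE !dE c00 in q1 q1'.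
have c10 : c 1%N 0%N = 0 by apply: etrans (sub0 _ _ q1' q1); ring.
have c11 : c 1%N 1%N = 0 by rewrite -q1 c10; ring.
have q2 := q (t * t); have q2' := q (t * t + 1); have q2'' := q (t * t + t).
rewrite !qformE !dE c00 c10 c11 in q2 q2' q2''.
(* Adding [1] to [t * t] changes the value by twice this coefficient. Here and below the factors 2,
   4, 6, 24 divide [24 = 4!], and a multiplier completes them to 24. *)
have c20 : c 2%N 0%N = 0.
  apply: (mulfI n24); rewrite mulr0 -[RHS](mulr0 12%:R).
  by rewrite -[in RHS](sub0 _ _ q2' q2); ring.
rewrite c20 in q2 q2''.
have c21 : c 2%N 1%N = 0.
  apply: (mulfI n24); rewrite mulr0 -[RHS](mulr0 12%:R).
  by rewrite -[in RHS](sub0 _ _ q2'' q2); ring.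
rewrite c21 in q2.
have c22 : c 2%N 2%N = 0.
  apply: (mulfI n24); rewrite mulr0 -[RHS](mulr0 6%:R) -[in RHS]q2; ring.
have q3 := q (t * t * t); have q3' := q (t * t * t + 1).
have q3'' := q (t * t * t + t).
rewrite !qformE !dE c00 c10 c11 c20 c21 c22 in q3 q3' q3''.
have c30 : c 3%N 0%N = 0.
  apply: (mulfI n24); rewrite mulr0 -[RHS](mulr0 4%:R).
  by rewrite -[in RHS](sub0 _ _ q3' q3); ring.
rewrite c30 in q3 q3''.
have c31 : c 3%N 1%N = 0.
  apply: (mulfI n24); rewrite mulr0 -[RHS](mulr0 4%:R).
  by rewrite -[in RHS](sub0 _ _ q3'' q3); ring.
have q4 := q (t * t * t * t); have q4' := q (t * t * t * t + 1).
rewrite !qformE !dE c00 c10 c11 c20 c21 c22 c30 c31 in q4 q4'.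
have c40 : c 4%N 0%N = 0.
  apply: (mulfI n24); rewrite mulr0.
  by rewrite -[in RHS](sub0 _ _ q4' q4); ring.
exact: quad_index_ind.
Qed.

(** * Uniqueness of the coefficients over [C(t)] *)

Section Independence.
Variable C : numFieldType.
Local Notation K := {fraction {poly C}}.

Lemma natr_ratfun_neq0 n : (n.+1%:R : K) != 0.
Proof.
by rewrite -(rmorph_nat (@tofrac _)) tofrac_eq0 -polyC_natr polyC_eq0 pnatr_eq0.
Qed.

(** The difference of the two forms vanishes at every rational function, so [qform_eq0] applies; 24
    is nonzero in characteristic zero. *)
Lemma quad_inj (c c' : nat -> nat -> K) :
    (forall (A : diffAlg C) (f : A), quad ddt c f = quad ddt c' f) ->
  forall k l, quad_index k l -> c k l = c' k l.
Proof.
move=> q k l kl; apply/eqP; rewrite -subr_eq0; apply/eqP; move: k l kl.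
apply: (@qform_eq0 K (@ratfun_ddt C) ('X%:F)).
- exact: natr_ratfun_neq0.
- exact: (@ddtD _ (ratfun_diffAlg C)).
- exact: (@ddtM _ (ratfun_diffAlg C)).
- by rewrite ratfun_ddt_poly derivX tofrac1.
move=> f; have /eqP := q (ratfun_diffAlg C) f; rewrite -subr_eq0 => /eqP qf.
rewrite -[RHS]qf /quad -sumrB; apply: eq_bigr => k _; rewrite -sumrB.
by apply: eq_bigr => l _; rewrite -scalerBl.
Qed.
End Independence.

(** * Hirota derivatives and the (H) form in coordinates *)

Section HirotaForms.
Variable C : fieldType.
Local Notation K := {fraction {poly C}}.

Lemma hirota2E (A : comAlgType K) (d : A -> A) f :
  hirota d 2 f f = 2%:R * (d (d f) * f) - 2%:R * (d f * d f).
Proof.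
rewrite /hirota !big_ord_recl big_ord0 /= /bump /=.
by rewrite !(add0n, addn0, add1n, subn0, subSS) /= ?binSn ?bin0 ?bin1 ?binn; ring.
Qed.

Lemma hirota4E (A : comAlgType K) (d : A -> A) f :
  hirota d 4 f f = 2%:R * (d (d (d (d f))) * f) - 8%:R * (d (d (d f)) * d f)
                 + 6%:R * (d (d f) * d (d f)).
Proof.
rewrite /hirota !big_ord_recl big_ord0 /= /bump /=.
rewrite !(add0n, addn0, add1n, subn0, subSS) /=.
have -> : 'C(4, 2) = 6%N by [].
by rewrite ?binSn ?bin0 ?bin1 ?binn; ring.
Qed.

Lemma ddt0 (A : diffAlg C) : ddt (0 : A) = 0.
Proof. by apply: (addIr (ddt 0)); rewrite -ddtD !add0r. Qed.

Lemma ddtN (A : diffAlg C) (x : A) : ddt (- x) = - ddt x.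
Proof. by apply: (addIr (ddt x)); rewrite -ddtD !addNr ddt0. Qed.

Lemma ddt_local_param (A : diffAlg C) (t0 : C) :
  ddt (local_param (Some t0))%:A = 1 :> A.
Proof.
rewrite /local_param tofracB scalerBl ddtD ddtN ddt_const subr0.
exact: ddt_t.
Qed.

Lemma deltaD (A : diffAlg C) (x y : A) : delta (x + y) = delta x + delta y.
Proof. by rewrite /delta ddtD scalerDr. Qed.

Lemma deltaN (A : diffAlg C) (x : A) : delta (- x) = - delta x.
Proof. by rewrite /delta ddtN scalerN. Qed.

Lemma deltaM (A : diffAlg C) (x y : A) : delta (x * y) = delta x * y + x * delta y.
Proof. by rewrite /delta ddtM scalerDr -scalerAl -scalerAr. Qed.

Lemma delta_u_infty (A : diffAlg C) (x : A) : delta_u None x = - delta x.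
Proof.
rewrite /delta_u /ddu /delta /= scalerN scalerA tofracXn expr2 mulKf //.
by rewrite tofrac_eq0 polyX_eq0.
Qed.

Lemma delta_uD p (A : diffAlg C) (x y : A) :
  delta_u p (x + y) = delta_u p x + delta_u p y.
Proof.
case: p => [t0|]; first by rewrite /delta_u /= ddtD scalerDr.
by rewrite !delta_u_infty deltaD opprD.
Qed.

Lemma delta_uN p (A : diffAlg C) (x : A) : delta_u p (- x) = - delta_u p x.
Proof.
case: p => [t0|]; first by rewrite /delta_u /= ddtN scalerN.
by rewrite !delta_u_infty deltaN.
Qed.

Lemma delta_uM p (A : diffAlg C) (x y : A) :
  delta_u p (x * y) = delta_u p x * y + x * delta_u p y.
Proof.
case: p => [t0|]; last by rewrite !delta_u_infty deltaM mulNr mulrN opprD.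
by rewrite /delta_u /= ddtM scalerDr -scalerAl -scalerAr.
Qed.

(** With [f_i] the [i]-th iterate of [delta_u] on [f], the entries [- 4] and [4] come from
    [-2 delta_u D^2], since [delta_u (2 f_2 f - 2 f_1^2) = 2 f_3 f - 2 f_2 f_1]. *)
Definition H_coef (alpha : C) (k l : nat) : C :=
  match k, l with
  | 4%N, 0%N => 2
  | 3%N, 1%N => - 8
  | 2%N, 2%N => 6
  | 3%N, 0%N => - 4
  | 2%N, 1%N => 4
  | 2%N, 0%N => 2 * (1 + 4 * alpha)
  | 1%N, 1%N => - (2 * (1 + 4 * alpha))
  | _, _ => 0
  end.

Lemma quad_H_coef p alpha (A : diffAlg C) (f : A) :
  H_form p alpha f = quad (@delta_u C p A) (fun k l => constK (H_coef alpha k l)) f.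
Proof.
rewrite quad_qform qformE /H_form hirota2E hirota4E.
(* All constants pass through one ring morphism; once it is abstract, a polynomial identity is left
   for [ring]. *)
pose g : {rmorphism C -> A} := in_alg A \o @tofrac _ \o @polyC C.
have gE c : (constK c)%:A = g c by [].
rewrite !gE -[_ *: (_ - _) in LHS]mulr_algl gE -[2 *: _]mulr_algl.
have -> : (2%:A : A) = g 2 by rewrite /= !rmorph_nat.
move: g {gE} => g.
have dn n x : delta_u p (n%:R * x) = n%:R * delta_u p x.
  elim: n => [|n IH]; last by rewrite -natr1 !mulrDl !mul1r delta_uD IH.
  by apply: (addIr (delta_u p (0%:R * x))); rewrite -delta_uD !mul0r !add0r.
rewrite !(delta_uD, delta_uN, dn, delta_uM) /H_coef.
ring.
Qed.

End HirotaForms.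

(** * From Euler operators to coefficients for [d/dt] *)

Section OperatorCoefficients.
Variable C : fieldType.
Local Notation K := {fraction {poly C}}.

(** [p0] to [p5] multiply [D^4], [delta D^2], [delta^2], [D^2], [delta] and [1]. With [f_i] the
    [i]-th iterate of [delta] on [f], [p2 + p3] and [p2 - p3] arise from
    [delta^2 (f^2) = 2 f_2 f + 2 f_1^2] and [D^2 f.f = 2 f_2 f - 2 f_1^2]. *)
Definition hirota_coef (p0 p1 p2 p3 p4 p5 : {poly C}) (k l : nat) : {poly C} :=
  match k, l with
  | 4%N, 0%N => 2 * p0
  | 3%N, 1%N => - (8 * p0)
  | 2%N, 2%N => 6 * p0
  | 3%N, 0%N => 2 * p1
  | 2%N, 1%N => - (2 * p1)
  | 2%N, 0%N => 2 * (p2 + p3)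
  | 1%N, 1%N => 2 * (p2 - p3)
  | 1%N, 0%N => 2 * p4
  | 0%N, 0%N => p5
  | _, _ => 0
  end.

Lemma quad_hirota_coef (p0 p1 p2 p3 p4 p5 : {poly C}) (A : diffAlg C) (f : A) :
  p0%:F *: hirota (@delta C A) 4 f f
  + p1%:F *: delta (hirota (@delta C A) 2 f f)
  + p2%:F *: delta (delta (f * f))
  + p3%:F *: hirota (@delta C A) 2 f f
  + p4%:F *: delta (f * f) + p5%:F *: (f * f)
  = quad (@delta C A) (fun k l => (hirota_coef p0 p1 p2 p3 p4 p5 k l)%:F) f.
Proof.
rewrite quad_qform qformE hirota2E hirota4E.
pose g : {rmorphism {poly C} -> A} := in_alg A \o @tofrac _.
have gE c : (c%:F)%:A = g c by [].
have gZ c (x : A) : c%:F *: x = g c * x by rewrite -mulr_algl.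
rewrite !gE !gZ.
move: g {gE gZ} => g.
have dn n (x : A) : delta (n%:R * x) = n%:R * delta x.
  elim: n => [|n IH]; last by rewrite -natr1 !mulrDl !mul1r deltaD IH.
  by apply: (addIr (delta (0%:R * x))); rewrite -deltaD !mul0r !add0r.
rewrite !(deltaD, deltaN, dn, deltaM) /hirota_coef.
ring.
Qed.

Lemma quad_delta (A : diffAlg C) (c : nat -> nat -> K) (f : A) :
  quad (@delta C A) c f
    = quad ddt (fun k l => 'X%:F ^+ (k + l) * euler_coef c k l) f.
Proof. by apply: quad_euler; apply: ddt_t. Qed.


(** At infinity [delta_u] is [- t d/dt], so [f^(k) f^(l)] carries a power of [t], not of the local
    parameter [1/t]. *)
Definition euler_param (p : option C) : K :=
  if p is Some _ then local_param p else 'X%:F.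

(* At infinity, [delta_u = - delta]. *)
Definition euler_twist (p : option C) (c : nat -> nat -> C) (k l : nat) : C :=
  if p is Some _ then c k l else (-1) ^+ (k + l) * c k l.

Lemma quad_delta_u p (A : diffAlg C) (c : nat -> nat -> C) (f : A) :
  quad (@delta_u C p A) (fun k l => constK (c k l)) f
  = quad ddt (fun k l =>
      euler_param p ^+ (k + l) * constK (euler_coef (euler_twist p c) k l)) f.
Proof.
pose g : {rmorphism C -> K} := @tofrac _ \o @polyC C.
have gE x : constK x = g x by [].
case: p => [t0|].
  rewrite quad_euler; last exact: ddt_local_param.
  apply: eq_quad => // k l _; rewrite gE raddf_euler_coef.
  by congr (_ * _); apply: eq_euler_coef.
rewrite (@eq_quad _ _ _ _ _ (fun k l => constK (c k l)) _ (@delta_u_infty C A)) //.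
rewrite quad_opp; last exact: deltaN.
rewrite quad_delta; apply: eq_quad => // k l _; rewrite gE raddf_euler_coef.
congr (_ * _); apply: eq_euler_coef => i j.
by rewrite -[RHS]/(g ((-1) ^+ (i + j) * c i j)) rmorphM rmorph_sign.
Qed.

End OperatorCoefficients.

(** * Local expansions of the coefficients under type (H) *)

Section TypeH.
Variable C : numFieldType.
Local Notation K := {fraction {poly C}}.
Implicit Type a : nat -> nat -> {poly C}.

(** What remains of the coefficient of [f^(k) f^(l)] in the (H) form once [euler_param p ^+ (k + l)]
    is removed. *)
Definition H_lead (p : option C) (alpha : C) : nat -> nat -> C :=
  euler_coef (euler_twist p (H_coef alpha)).

Lemma euler_coefZ (x : C) (c : nat -> nat -> C) k l :
  euler_coef (fun i j => x * c i j) k l = x * euler_coef c k l.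
Proof.
by case: k l => [|[|[|[|[|k]]]]] [|[|[|l]]];
  rewrite /= ?mulr0 // !mulrDr ?mulrnAr.
Qed.

Lemma euler_twistZ p (x : C) (c : nat -> nat -> C) k l :
  euler_twist p (fun i j => x * c i j) k l = x * euler_twist p c k l.
Proof. by case: p => //=; rewrite mulrCA. Qed.

Lemma euler_param_neq0 (p : option C) : euler_param p != 0.
Proof.
by case: p => [t0|]; rewrite /= tofrac_eq0 ?polyXsubC_eq0 // polyX_eq0.
Qed.

(** Each [P_j] is rewritten with [d/dt] by [quad_delta_u]; [quad_inj] then compares coefficients,
    for the whole expansion and for [P_0] against the (H) form. *)
Lemma typeH_coef a p : typeH a p ->
  exists (N : int) (n : nat) (s : nat -> nat -> nat -> C) (kappa alpha : C),
  kappa != 0 /\ forall k l, quad_index k l ->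
    (a k l)%:F = euler_param p ^+ (k + l) *
      \sum_(j < n.+1) local_param p ^ (N + j%:Z) * constK (s j k l)
    /\ s 0%N k l = kappa * H_lead p alpha k l.
Proof.
move=> [N [n [c [ae [kappa [alpha [kappa_neq0 ce]]]]]]].
exists N, n, (fun j => euler_coef (euler_twist p (c j))), kappa, alpha.
split=> // k l kl; split; move: k l kl.
  apply: quad_inj => A f; rewrite -/(lhs a f) ae.
  under eq_bigr do rewrite quad_delta_u quadZ.
  rewrite quad_sum; apply: eq_quad => // k l _; rewrite mulr_sumr.
  by apply: eq_bigr => j _; rewrite mulrCA.
move=> k l kl.
have e0 (A : diffAlg C) (f : A) :
    quad (@delta_u C p A) (fun k l => constK (c 0%N k l)) f
  = quad (@delta_u C p A) (fun k l => constK (kappa * H_coef alpha k l)) f.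
  rewrite ce quad_H_coef quadZ; apply: eq_quad => // i j _.
  by rewrite -tofracM -polyCM.
have e1 (A : diffAlg C) (f : A) :=
  etrans (etrans (esym (quad_delta_u p _ f)) (e0 A f)) (quad_delta_u p _ f).
have := quad_inj e1 kl.
move/(mulfI (expf_neq0 _ (euler_param_neq0 p)))/eqP.
rewrite tofrac_eq => /eqP/polyC_inj ->.
rewrite -euler_coefZ; apply: eq_euler_coef => i j; exact: euler_twistZ.
Qed.

(** The expansion is gathered into one polynomial in [t - t0], whose value at [t0] retains only the
    term [j = 0]. *)
Lemma typeH_finite a (t0 : C) : typeH a (Some t0) ->
  exists (N : int) (kappa alpha : C) (Q : nat -> nat -> {poly C}),
  kappa != 0 /\ forall k l, quad_index k l ->
    (a k l)%:F = ('X - t0%:P)%:F ^ ((k + l)%:Z + N) * (Q k l)%:F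
    /\ (Q k l).[t0] = kappa * H_lead (Some t0) alpha k l.
Proof.
move=> /typeH_coef[N [n [s [kappa [alpha [kappa_neq0 e]]]]]].
exists N, kappa, alpha, (fun k l => \sum_(j < n.+1) s j k l *: ('X - t0%:P) ^+ j).
have u_neq0 := euler_param_neq0 (Some t0).
split=> // k l kl; have [-> <-] := e k l kl; split.
  rewrite expfzDr // -mulrA; congr (_ * _).
  rewrite rmorph_sum mulr_sumr; apply: eq_bigr => j _.
  rewrite expfzDr // -mulrA -mul_polyC rmorphM rmorphXn /=.
  by congr (_ * _); rewrite mulrC.
rewrite horner_sum big_ord_recl big1 => [|j _].
  by rewrite hornerZ expr0 hornerC mulr1 addr0.
by rewrite hornerZ horner_exp hornerXsubC subrr exprS mul0r mulr0.
Qed.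

(** Taking out the highest power of [1/t] reverses the expansion: the term [j] gets [t^(n-j)], so
    the leading term [j = 0] sits in degree [n]. *)
Lemma typeH_infty a : typeH a None ->
  exists (N : int) (n : nat) (kappa alpha : C) (W : nat -> nat -> {poly C}),
  kappa != 0 /\ forall k l, quad_index k l ->
    [/\ (a k l)%:F = 'X%:F ^ ((k + l)%:Z - (N + n%:Z)) * (W k l)%:F,
        (size (W k l) <= n.+1)%N
      & (W k l)`_n = kappa * H_lead None alpha k l].
Proof.
move=> /typeH_coef[N [n [s [kappa [alpha [kappa_neq0 e]]]]]].
exists N, n, kappa, alpha, (fun k l => \poly_(i < n.+1) s (n - i)%N k l).
have t_neq0 := euler_param_neq0 None.
split=> // k l kl; have [-> <-] := e k l kl; split.
- rewrite expfzDr // -mulrA; congr (_ * _).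
  rewrite poly_def rmorph_sum mulr_sumr (reindex_inj rev_ord_inj) /=.
  apply: eq_bigr => j _; rewrite subSS -mul_polyC rmorphM rmorphXn /=.
  have jn : (j <= n)%N by rewrite -ltnS.
  rewrite mulrCA mulrC; congr (_ * _).
  rewrite exprnP -expfzDr // exprz_inv; congr (_ ^ _).
  by rewrite -subzn //; ring.
- exact: size_poly.
- by rewrite coef_poly ltnSn subnn.
Qed.

End TypeH.

(** * Orders of vanishing, degrees and factorization *)

Section Order.
Variable C : fieldType.
Local Notation K := {fraction {poly C}}.

(** After cancelling the smaller power, an excess factor [X - c] on one side would force the other
    side to vanish at [c]. *)
Lemma order_unique (c : C) (y z : int) (p q : {poly C}) :
    p.[c] != 0 -> q.[c] != 0 ->
    ('X - c%:P)%:F ^ y * p%:F = ('X - c%:P)%:F ^ z * q%:F ->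
  y = z /\ p = q.
Proof.
have u_neq0 : ('X - c%:P)%:F != 0 by rewrite tofrac_eq0 polyXsubC_eq0.
wlog le_yz : y z p q / y <= z => [wl pc qc e|].
  by case: (leP y z) => [|/ltW] le; [exact: wl|case: (wl z y q p)].
move=> pc qc.
have [n ->] : exists n : nat, z = y + n%:Z.
  by exists `|z - y|%N; rewrite gez0_abs ?subr_ge0 //; ring.
rewrite expfzDr // -mulrA => /(mulfI (expfz_neq0 _ u_neq0)).
rewrite -exprnP -rmorphXn -rmorphM => /eqP; rewrite tofrac_eq => /eqP e.
case: n e pc => [|n] ->; first by rewrite addr0 expr0 mul1r.
by rewrite hornerM horner_exp hornerXsubC subrr exprS !mul0r eqxx.
Qed.

Lemma size_mulXz (z : int) (p q : {poly C}) : p != 0 ->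
  p%:F * 'X%:F ^ z = q%:F -> (size p)%:Z + z = (size q)%:Z.
Proof.
have t_neq0 : 'X%:F != 0 :> K by rewrite tofrac_eq0 polyX_eq0.
move=> p_neq0; case: z => n.
  rewrite -exprnP -rmorphXn -rmorphM => /eqP; rewrite tofrac_eq => /eqP <-.
  by rewrite size_mulXn // addnC PoszD.
move=> e; have {}e : p = q * 'X^(n.+1).
  apply/eqP; rewrite -tofrac_eq tofracM tofracXn -e NegzE -exprnN.
  by rewrite divfK; last exact: expf_neq0.
have q_neq0 : q != 0 by apply: contraNneq p_neq0 => q0; rewrite e q0 mul0r.
by rewrite e size_mulXn // NegzE addnC PoszD addrK.
Qed.

(** Only one term of the convolution meets both degree bounds. *)
Lemma coef_top_mul (i j : nat) (p q : {poly C}) :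
    (size p <= i.+1)%N -> (size q <= j.+1)%N ->
  (p * q)`_(i + j) = p`_i * q`_j.
Proof.
move=> pi qj; have lt_i : (i < (i + j).+1)%N by rewrite ltnS leq_addr.
rewrite coefM (bigD1 (Ordinal lt_i)) //= addKn big1 ?addr0 // => k.
rewrite -val_eqE /= neq_ltn => /orP[ki|ik].
  rewrite [q`__]nth_default ?mulr0 // (leq_trans qj) //.
  by lia.
by rewrite nth_default ?mul0r // (leq_trans pi).
Qed.

End Order.

Lemma root01_factor (C : closedFieldType) (p : {poly C}) : p != 0 ->
    (forall x, root p x -> x = 0 \/ x = 1) ->
  exists lambda m n, lambda != 0 /\ p = lambda *: ('X^m * ('X - 1%:P) ^+ n).
Proof.
move=> p_neq0 rp; have [r e] := closed_field_poly_normal p.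
have r01 x : x \in r -> x = 0 \/ x = 1.
  by move=> xr; apply: rp; rewrite e rootZ ?lead_coef_eq0 // root_prod_XsubC.
have [m [n er]] : exists m n,
    \prod_(z <- r) ('X - z%:P) = 'X^m * ('X - 1%:P) ^+ n :> {poly C}.
  elim: r {e} r01 => [|x r IH] r01.
    by exists 0%N, 0%N; rewrite big_nil !expr0 mulr1.
  have [y yr|m [n er]] := IH; first by apply: r01; rewrite inE yr orbT.
  rewrite big_cons er; case: (r01 x (mem_head x r)) => ->.
    by exists m.+1, n; rewrite subr0 exprS mulrA.
  by exists m, n.+1; rewrite exprS mulrCA.
by exists (lead_coef p), m, n; rewrite lead_coef_eq0 -er.
Qed.

(** * Gluing the three local expansions *)

Section NormalForm.
Variable C : numClosedFieldType.
Local Notation K := {fraction {poly C}}.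
Local Notation t := ('X%:F : K).
Local Notation u := (('X - 1%:P)%:F : K).

(* [f delta_u^4 f] has coefficient 2 in the (H) form at every point, which
   identifies the three constants [kappa]. *)
Lemma H_lead40 p (alpha : C) : H_lead p alpha 4%N 0%N = 2.
Proof. by case: p => [t0|] //=; rewrite /H_lead /= -signr_odd expr0 mul1r. Qed.

Lemma typeH01infty_coef (a : nat -> nat -> {poly C}) :
    a 4%N 0%N != 0 ->
    (forall x, root (a 4%N 0%N) x -> x = 0 \/ x = 1) ->
    typeH a (Some 0) -> typeH a (Some 1) -> typeH a None ->
  exists (N : int) (n : nat) (kappa al0 al1 al2 : C)
    (e : nat -> nat -> {poly C}), kappa != 0 /\
    forall k l, quad_index k l ->
    [/\ (a k l)%:F = constK kappa * t ^ ((k + l)%:Z + N)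
                      * u ^ ((k + l)%:Z + n%:Z - 4%:Z) * (e k l)%:F,
        (size (e k l) <= 5 - (k + l))%N,
        (e k l)`_0 = (-1) ^+ (k + l) * H_lead (Some 0) al0 k l,
        (e k l).[1] = H_lead (Some 1) al1 k l
      & (e k l)`_(4 - (k + l))%N = H_lead None al2 k l].
Proof.
move=> a_neq0 ra.
have [lam [m [n [lam_neq0 a40]]]] := root01_factor a_neq0 ra.
move=> /typeH_finite[N [ka0 [al0 [P [ka0_neq0 eP]]]]].
move=> /typeH_finite[N1 [ka1 [al1 [Q [ka1_neq0 eQ]]]]].
move=> /typeH_infty[N2 [n2 [ka2 [al2 [W [ka2_neq0 eW]]]]]].
have t_neq0 : t != 0 by rewrite tofrac_eq0 polyX_eq0.
have u_neq0 : u != 0 by rewrite tofrac_eq0 polyXsubC_eq0.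
have i40 : quad_index 4 0 by [].
have two_neq0 : 2 != 0 :> C by rewrite pnatr_eq0.
(* The order of [a 4 0] at 0 is [m] by the factorization, and [4 + N] by the expansion, as [P 4 0]
   has the nonzero value [ka0 * 2] there. *)
have [Nm P40] : m%:Z = 4%:Z + N /\ lam *: ('X - 1%:P) ^+ n = P 4%N 0%N.
  have [aP P0] := eP _ _ i40.
  apply: (@order_unique _ 0).
  - rewrite hornerZ horner_exp hornerXsubC sub0r mulf_neq0 //.
    by rewrite expf_neq0 // oppr_eq0 oner_eq0.
  - by rewrite P0 H_lead40 mulf_neq0.
  - rewrite -[RHS]aP a40 polyC0 subr0 -exprnP -tofracXn -tofracM.
    by rewrite scalerAr.
have [Nn _] : n%:Z = 4%:Z + N1 /\ lam *: 'X^m = Q 4%N 0%N.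
  have [aQ Q0] := eQ _ _ i40.
  apply: (@order_unique _ 1).
  - by rewrite hornerZ hornerXn expr1n mulr1.
  - by rewrite Q0 H_lead40 mulf_neq0.
  - rewrite -[RHS]aQ a40 -exprnP -tofracXn -tofracM.
    by rewrite mulrC -scalerAl.
have PW k l : quad_index k l ->
    (P k l)%:F * t ^ (N + N2 + n2%:Z) = (W k l)%:F.
  move=> kl; have [aP _] := eP k l kl; have [aW _ _] := eW k l kl.
  move: aP; rewrite polyC0 subr0 aW => aP.
  apply: (mulfI (expfz_neq0 ((k + l)%:Z - (N2 + n2%:Z)) t_neq0)).
  rewrite aP mulrCA -(expfzDr _ _ t_neq0) mulrC.
  by congr (_ ^ _ * _); ring.
(* Compare degrees: [P 4 0] has degree [n], and [W 4 0] has degree [n2] because its top coefficient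
   [ka2 * 2] is nonzero. *)
have zn : N + N2 + n2%:Z = n2%:Z - n%:Z.
  have [_ W_le W_top] := eW _ _ i40.
  have sW : size (W 4%N 0%N) = n2.+1.
    apply/eqP; rewrite eqn_leq W_le ltnNge.
    apply/negP => /leq_sizeP/(_ n2 (leqnn _)).
    by move/eqP; rewrite W_top H_lead40 mulf_eq0 (negPf ka2_neq0) (negPf two_neq0).
  have P_neq0 : P 4%N 0%N != 0.
    by rewrite -P40 scaler_eq0 (negPf lam_neq0) expf_neq0 // polyXsubC_eq0.
  have := size_mulXz P_neq0 (PW _ _ i40).
  rewrite -P40 size_scale // size_exp_XsubC sW; move: (N + N2 + _) => z; clear; lia.
(* [P k l] and [W k l] differ by the power [n2 - n] of [t], which carries the degree bound and the
   top coefficient over to [P k l]. *)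
have P_top k l : quad_index k l ->
    (size (P k l) <= n.+1)%N /\ (P k l)`_n = ka2 * H_lead None al2 k l.
  move=> kl; have [_ W_le W_top] := eW _ _ kl.
  have e : P k l * 'X^n2 = W k l * 'X^n.
    apply/eqP; rewrite -tofrac_eq !tofracM !tofracXn -(PW _ _ kl) zn.
    by rewrite -mulrA exprnP [t ^+ n]exprnP -(expfzDr _ _ t_neq0) subrK.
  have ce i : (n <= i)%N -> (P k l)`_i = (W k l)`_(i + n2 - n).
    move=> ni; have := congr1 (fun p : {poly C} => p`_(i + n2)) e.
    by rewrite !coefMXn ltnNge leq_addl addnK ltnNge (leq_trans ni (leq_addr _ _)).
  split; last by rewrite ce // addnC addnK.
  apply/leq_sizeP => i ni; rewrite ce ?(ltnW ni) //.
  by rewrite nth_default // (leq_trans W_le) // ltn_subRL ltn_add2r.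
pose w : {poly C} := 'X - 1%:P.
have w_neq0 i : w ^+ i != 0 by rewrite expf_neq0 // polyXsubC_eq0.
(* The expansions at 0 and 1 are equated and multiplied by [t^(4-k-l) (t-1)^(4-k-l)], which turns
   the outer exponents into [m] and [n]. *)
have PQ k l : quad_index k l ->
    'X^m * (w ^+ (4 - (k + l)) * P k l) = 'X^(4 - (k + l)) * (w ^+ n * Q k l).
  move=> kl; have [aP _] := eP k l kl; have [aQ _] := eQ k l kl.
  have {}kl : (k + l <= 4)%N by case/andP: kl.
  apply/eqP; rewrite -tofrac_eq !tofracM !tofracXn.
  have -> : t ^+ m = t ^+ (4 - (k + l)) * t ^ ((k + l)%:Z + N).
    rewrite !exprnP -(expfzDr _ _ t_neq0) Nm -subzn //.
    by congr (_ ^ _); ring.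
  have -> : u ^+ n = u ^+ (4 - (k + l)) * u ^ ((k + l)%:Z + N1).
    rewrite !exprnP -(expfzDr _ _ u_neq0) Nn -subzn //.
    by congr (_ ^ _); ring.
  move: aP; rewrite polyC0 subr0 aQ => aP.
  apply/eqP; rewrite -!mulrA; congr (_ * _).
  by rewrite mulrCA aP.
(* The division is exact: by [PQ], [w ^+ n] divides [t^m] times the dividend, and it is coprime to
   [t^m]. *)
pose e k l := (w ^+ (4 - (k + l)) * P k l) %/ w ^+ n.
have eP' k l : quad_index k l -> w ^+ n * e k l = w ^+ (4 - (k + l)) * P k l.
  move=> kl; rewrite mulrC divpK // -(@Gauss_dvdpr _ _ 'X^m).
    by rewrite PQ // mulrCA dvdp_mulIl.
  rewrite coprimep_expl // coprimep_expr // coprimep_sym.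
  by rewrite coprimep_XsubC rootX oner_eq0.
have eQ' k l : quad_index k l -> 'X^m * e k l = 'X^(4 - (k + l)) * Q k l.
  move=> kl; apply: (mulfI (w_neq0 n)).
  by rewrite mulrCA eP' // PQ // mulrCA.
have e1 k l : quad_index k l -> (e k l).[1] = ka1 * H_lead (Some 1) al1 k l.
  move=> kl; have [_ <-] := eQ _ _ kl; have := congr1 (horner^~ 1) (eQ' _ _ kl).
  by rewrite !hornerM !hornerXn !expr1n !mul1r.
(* At 0 the powers of [w] evaluate to signs, and [4 - (k + l)] has the parity of [k + l]. *)
have e0 k l : quad_index k l ->
    (e k l)`_0 = (-1) ^+ (k + l) * ((-1) ^+ n * ka0 * H_lead (Some 0) al0 k l).
  move=> kl; have [_ P0] := eP _ _ kl; have := congr1 (horner^~ 0) (eP' _ _ kl).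
  rewrite !hornerM !horner_exp !hornerXsubC sub0r P0 -horner_coef0.
  have {}kl : (k + l <= 4)%N by case/andP: kl.
  have s2 : (-1) ^+ n * (-1) ^+ n = 1 :> C by rewrite -exprMn mulrNN mul1r expr1n.
  move=> e0; have -> : (e k l).[0] = (-1) ^+ n * ((-1) ^+ n * (e k l).[0]).
    by rewrite mulrA s2 mul1r.
  rewrite e0.
  have -> : (-1) ^+ (4 - (k + l)) = (-1) ^+ (k + l) :> C.
    by rewrite -signr_odd oddB // signr_odd.
  by rewrite !mulrA; congr (_ * _); rewrite -!mulrA mulrCA.
have e_top k l : quad_index k l -> (size (e k l) <= 5 - (k + l))%N /\
    (e k l)`_(4 - (k + l))%N = ka2 * H_lead None al2 k l.
  move=> kl; have [P_le P_n] := P_top _ _ kl.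
  have se : (size (e k l) <= (4 - (k + l)).+1)%N.
    have [->|e_neq0] := eqVneq (e k l) 0; first by rewrite size_poly0.
    have P_neq0 : P k l != 0.
      apply: contraNneq (mulf_neq0 (w_neq0 n) e_neq0) => P0.
      by rewrite eP' // P0 mulr0.
    have := congr1 (fun p : {poly C} => size p) (eP' _ _ kl).
    rewrite !size_mul // !size_exp_XsubC !addSn /= => es.
    by rewrite -(leq_add2l n) es addnS -addSn addnC leq_add2r.
  split; first by rewrite subSn //; case/andP: kl.
  have w_lead i : (w ^+ i)`_i = 1.
    have /monicP := monic_exp i (monicXsubC (1 : C)).
    by rewrite /lead_coef size_exp_XsubC.
  have wn_le i : (size (w ^+ i) <= i.+1)%N by rewrite /w size_exp_XsubC.
  rewrite -P_n -[RHS]mul1r -(w_lead (4 - (k + l))%N) -coef_top_mul //.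
  rewrite -eP' // [(_ + n)%N]addnC.
  by rewrite coef_top_mul // w_lead mul1r.
(* [e 4 0] is a constant polynomial, so its values at 0 and 1 and its top coefficient coincide. *)
have [ka01 ka21] : (-1) ^+ n * ka0 = ka1 /\ ka2 = ka1.
  have [e_le et] := e_top _ _ i40.
  have e1' := e1 _ _ i40; have e0' := e0 _ _ i40.
  rewrite (size1_polyC e_le) hornerC in e1'; rewrite e1' in et e0'.
  move: et e0'; rewrite !H_lead40 => /(mulIf two_neq0) -> .
  by rewrite -signr_odd expr0 mul1r => /(mulIf two_neq0) ->.
exists N, n, ka1, al0, al1, al2, (fun k l => ka1^-1 *: e k l); split=> // k l kl.
have [e_le et] := e_top _ _ kl.
split.
- have [aP _] := eP _ _ kl; rewrite aP polyC0 subr0.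
  have kl4 : (k + l <= 4)%N by case/andP: kl.
  have -> : (P k l)%:F = u ^ ((k + l)%:Z + n%:Z - 4%:Z) * (e k l)%:F.
    apply: (mulfI (expf_neq0 (4 - (k + l)) u_neq0)).
    rewrite mulrA exprnP -(expfzDr _ _ u_neq0) -exprnP -tofracXn -tofracM.
    rewrite -eP' // tofracM tofracXn exprnP; congr (_ ^ _ * _).
    by rewrite -subzn //; ring.
  have kk : constK ka1 * constK ka1^-1 = 1 by rewrite -tofracM -polyCM mulfV.
  rewrite -mul_polyC tofracM -/(constK _).
  move: (t ^ _) (u ^ _) ((e k l)%:F) (constK _) (constK _) kk => T U E c c' cc'.
  by rewrite -[LHS]mul1r -cc'; ring.
- by rewrite size_scale // invr_eq0.
- by rewrite coefZ e0 // ka01 mulrCA mulKf.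
- by rewrite hornerZ e1 // mulKf.
- by rewrite coefZ et ka21 mulKf.
Qed.
End NormalForm.

(** * Interpolation and the six parameters *)

Section Interpolation.
Variable C : numFieldType.
Implicit Type p : {poly C}.

Definition L_coef (b1 b2 b3 b4 b5 b6 : C) : nat -> nat -> {poly C} :=
  let t : {poly C} := 'X in
  hirota_coef ((t - 1) ^+ 4) (2%:R * (t - 1) ^+ 3 * (t + 1))
    (t * (t - 1) ^+ 2)
    ((t - 1) ^+ 2 * (t * (t - 1) + 1 - b1%:P - b5%:P * t - b6%:P * t ^+ 2))
    (t * (t - 1) * (b4%:P * (t - 1) - b1%:P - b5%:P - b6%:P))
    (t * (t - 1) * (b2%:P * t + b3%:P)).

Lemma poly_interp3 p : (size p <= 3)%N ->
  p = (p`_0)%:P + (p.[1] - p`_0 - p`_2)%:P * 'X + (p`_2)%:P * 'X^2.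
Proof.
move=> p_le; have pE : p = (p`_0)%:P + (p`_1)%:P * 'X + (p`_2)%:P * 'X^2.
  apply/polyP => i; rewrite !(coefD, coefCM, coefC, coefX, coefXn).
  case: i => [|[|[|i]]] /=; rewrite ?(mulr0, mulr1, addr0, add0r) //.
  by rewrite nth_default // (leq_trans p_le).
have -> : p.[1] = p`_0 + p`_1 + p`_2.
  by rewrite [in LHS]pE !(hornerD, hornerM, hornerC, hornerX, hornerXn); ring.
by rewrite [LHS]pE; ring.
Qed.

(** The value at 1 eliminates the quadratic coefficient. Those of degrees 1 and 3 are the free ones
    of [e 0 0]; for [e 1 0] the cubic one is the prescribed top coefficient. *)
Lemma poly_interp5 p : (size p <= 5)%N ->
  p = (p`_0)%:P + (p`_1)%:P * 'X
    + (p.[1] - p`_0 - p`_1 - p`_3 - p`_4)%:P * 'X^2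
    + (p`_3)%:P * 'X^3 + (p`_4)%:P * 'X^4.
Proof.
move=> p_le; have pE : p = (p`_0)%:P + (p`_1)%:P * 'X + (p`_2)%:P * 'X^2
    + (p`_3)%:P * 'X^3 + (p`_4)%:P * 'X^4.
  apply/polyP => i; rewrite !(coefD, coefCM, coefC, coefX, coefXn).
  case: i => [|[|[|[|[|i]]]]] /=; rewrite ?(mulr0, mulr1, addr0, add0r) //.
  by rewrite nth_default // (leq_trans p_le).
have -> : p.[1] = p`_0 + p`_1 + p`_2 + p`_3 + p`_4.
  by rewrite [in LHS]pE !(hornerD, hornerM, hornerC, hornerX, hornerXn); ring.
by rewrite [LHS]pE; ring.
Qed.

Lemma L_coef_interpolation (al0 al1 al2 : C) (e : nat -> nat -> {poly C}) :
    (forall k l, quad_index k l ->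
    [/\ (size (e k l) <= 5 - (k + l))%N,
        (e k l)`_0 = (-1) ^+ (k + l) * H_lead (Some 0) al0 k l,
        (e k l).[1] = H_lead (Some 1) al1 k l
      & (e k l)`_(4 - (k + l))%N = H_lead None al2 k l]) ->
  exists b1 b2 b3 b4 b5 b6 : C, forall k l, quad_index k l ->
    ('X - 1%:P) ^+ (k + l) * e k l = euler_coef (L_coef b1 b2 b3 b4 b5 b6) k l.
Proof.
move=> h.
(* The data of [e 2 0] at 0, 1 and infinity force [b1 = -4 al0], [b1 + b5 + b6 = -4 al1] and
   [b6 = -4 al2]. Since [e 0 0] must be [t (t-1) (b2 t + b3)], its coefficients of degrees 3 and 1
   are [b2] and [-b3]. The linear coefficient of [e 1 0] gives [b4]. *)
exists (- 4 * al0), (e 0%N 0%N)`_3, (- (e 0%N 0%N)`_1),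
  (2 + 8 * al0 + 4 * al2 - (e 1%N 0%N)`_1 / 2),
  (4 * (al0 + al2 - al1)), (- 4 * al2).
have interp3 k l : quad_index k l -> (2 <= k + l)%N ->
    e k l = ((e k l)`_0)%:P + ((e k l).[1] - (e k l)`_0 - (e k l)`_2)%:P * 'X
            + ((e k l)`_2)%:P * 'X^2.
  move=> /h[e_le _ _ _] kl; apply: poly_interp3; apply: leq_trans e_le _.
  by rewrite leq_subLR; apply: (@leq_add 2 3).
(* The interpolation formulas mention degree 2 even when [k + l >= 3], and degree 4 for [e 1 0];
   these coefficients lie above the degree bound. *)
have small k l i : quad_index k l -> (4 - (k + l) < i)%N -> (e k l)`_i = 0.
  move=> kl i_lt; have [e_le _ _ _] := h _ _ kl; apply: nth_default.
  by apply: leq_trans e_le _; move: i_lt; case/andP: kl => _ kl; rewrite -subSn.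
(* The half is later generalised to [y], so that [ring] meets no division. *)
have half : (e 1%N 0%N)`_1 = 2 * ((e 1%N 0%N)`_1 / 2) by field.
have coefs k l i : quad_index k l -> (4 - (k + l))%N = i ->
    [/\ (e k l)`_0 = (-1) ^+ (k + l) * H_lead (Some 0) al0 k l,
        (e k l).[1] = H_lead (Some 1) al1 k l
      & (e k l)`_i = H_lead None al2 k l].
  by move=> /h[_ z o tp] <-.
apply: quad_index_ind.
- have [z o tp] := coefs 0%N 0%N 4%N isT erefl; have [e_le _ _ _] := h 0%N 0%N isT.
  rewrite [in LHS](poly_interp5 e_le) z o tp /H_lead !(addn0, addnS) /=; ring.
- have [z o tp] := coefs 1%N 0%N 3%N isT erefl; have [e_le _ _ _] := h 1%N 0%N isT.
  rewrite [in LHS](poly_interp5 (leq_trans e_le _)) // z o tp (small _ _ 4%N) //.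
  move: (_ / 2) half => y ->; rewrite /H_lead !(addn0, addnS) /=; ring.
- have [z o tp] := coefs 1%N 1%N 2%N isT erefl.
  rewrite [in LHS]interp3 // z o tp /H_lead !(addn0, addnS) /=; ring.
- have [z o tp] := coefs 2%N 0%N 2%N isT erefl.
  rewrite [in LHS]interp3 // z o tp /H_lead !(addn0, addnS) /=; ring.
- have [z o tp] := coefs 2%N 1%N 1%N isT erefl.
  rewrite [in LHS]interp3 // z o small // /H_lead !(addn0, addnS) /=; ring.
- have [z o tp] := coefs 2%N 2%N 0%N isT erefl.
  rewrite [in LHS]interp3 // z o small // /H_lead !(addn0, addnS) /=; ring.
- have [z o tp] := coefs 3%N 0%N 1%N isT erefl.
  rewrite [in LHS]interp3 // z o small // /H_lead !(addn0, addnS) /=; ring.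
- have [z o tp] := coefs 3%N 1%N 0%N isT erefl.
  rewrite [in LHS]interp3 // z o small // /H_lead !(addn0, addnS) /=; ring.
- have [z o tp] := coefs 4%N 0%N 0%N isT erefl.
  rewrite [in LHS]interp3 // z o small // /H_lead !(addn0, addnS) /=; ring.
Qed.
End Interpolation.

(** * The multiplier and the final comparison with [Lff] *)

Lemma Lff_quad (C : numFieldType) (b1 b2 b3 b4 b5 b6 : C) (A : diffAlg C) (f : A) :
  Lff b1 b2 b3 b4 b5 b6 f =
  quad ddt (fun k l => 'X%:F ^+ (k + l) *
    (euler_coef (L_coef b1 b2 b3 b4 b5 b6) k l)%:F) f.
Proof.
transitivity (quad (@delta C A) (fun k l => (L_coef b1 b2 b3 b4 b5 b6 k l)%:F) f).
  by rewrite -quad_hirota_coef.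
rewrite quad_delta; apply: eq_quad => // k l _.
by rewrite raddf_euler_coef.
Qed.

Lemma typeH01infty_Lff (C : numClosedFieldType) (a : nat -> nat -> {poly C}) :
    a 4%N 0%N != 0 ->
    (forall x, root (a 4%N 0%N) x -> x = 0 \/ x = 1) ->
    typeH a (Some 0) -> typeH a (Some 1) -> typeH a None ->
  exists b1 b2 b3 b4 b5 b6 : C,
  exists r : {fraction {poly C}}, r != 0 /\
    forall (A : diffAlg C) (f : A),
      r *: lhs a f = Lff b1 b2 b3 b4 b5 b6 f.
Proof.
move=> a40_neq0 ra H0 H1 Hinfty.
have [N [n [kappa [al0 [al1 [al2 [e [kappa_neq0 h]]]]]]]] :=
  typeH01infty_coef a40_neq0 ra H0 H1 Hinfty.
have [|b1 [b2 [b3 [b4 [b5 [b6 eL]]]]]] := @L_coef_interpolation _ al0 al1 al2 e.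
  by move=> k l /h[].
pose t : {fraction {poly C}} := 'X%:F.
pose u : {fraction {poly C}} := ('X - 1%:P)%:F.
have t_neq0 : t != 0 by rewrite tofrac_eq0 polyX_eq0.
have u_neq0 : u != 0 by rewrite tofrac_eq0 polyXsubC_eq0.
have k_neq0 : constK kappa != 0 by rewrite tofrac_eq0 polyC_eq0.
(* This factor cancels [kappa], [t^N] and [(t-1)^(n-4)]; the coefficient of [f^(k) f^(l)] becomes
   [t^(k+l) (t-1)^(k+l) e_kl], as in [Lff]. *)
exists b1, b2, b3, b4, b5, b6, ((constK kappa)^-1 * t ^ (- N) * u ^ (4%:Z - n%:Z)).
split=> [|A f].
  exact: (mulf_neq0 (mulf_neq0 (invr_neq0 k_neq0) (expfz_neq0 (- N) t_neq0))
    (expfz_neq0 (4%:Z - n%:Z) u_neq0)).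
rewrite Lff_quad quadZ; apply: eq_quad => // k l kl.
have [-> _ _ _ _] := h k l kl; rewrite -eL // tofracM tofracXn -/t -/u !exprnP.
have -> : t ^ (k + l)%N = t ^ (- N) * t ^ ((k + l)%:Z + N).
  by rewrite -(expfzDr _ _ t_neq0); congr (_ ^ _); ring.
have -> : u ^ (k + l)%N = u ^ (4%:Z - n%:Z) * u ^ ((k + l)%:Z + n%:Z - 4%:Z).
  by rewrite -(expfzDr _ _ u_neq0); congr (_ ^ _); ring.
move: (t ^ _) (t ^ _) (u ^ _) (u ^ _) (e k l)%:F => T T' U U' E.
have kk : (constK kappa)^-1 * constK kappa = 1 by apply: mulVf.
move: (constK kappa) (constK kappa)^-1 kk => c c' cc'.
by rewrite -[RHS]mul1r -cc'; ring.
Qed.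

Theorem theorem4p1 (R : realType) (a : nat -> nat -> {poly R[i]})
    (a40_neq0 : a 4%N 0%N != 0)
    (sing : forall p : option R[i],
        fixed_singular a p <-> [\/ p = Some 0, p = Some 1 | p = None])
    (H0 : typeH a (Some 0))
    (H1 : typeH a (Some 1))
    (Hinfty : typeH a None) :
  exists b1 b2 b3 b4 b5 b6 : R[i],
  exists r : {fraction {poly R[i]}}, r != 0 /\
    forall (A : diffAlg R[i]) (f : A),
      r *: lhs a f = Lff b1 b2 b3 b4 b5 b6 f.
Proof.
(* At a finite point [fixed_singular] unfolds to [root]. *)
have ra x : root (a 4%N 0%N) x -> x = 0 \/ x = 1.
  by move/(sing (Some x)).1 => [[]|[]|] // ->; [left|right].
exact: typeH01infty_Lff.
Qed.
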